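(* Assume $\underline{\gamma} < \overline{\gamma} < 0$ and $\underline{\beta} < 0 < \overline{\beta}$. Then $\operatorname{conv}(T) = R^2$.
   Context: Let $\underline{\gamma}, \overline{\gamma}, \underline{\beta}, \overline{\beta}$ be real parameters; $\operatorname{conv}$ denotes the convex hull. The set $T \subseteq \mathbb{R}^5$ consists of all $(x,u,y,z,t)$ satisfying $$u = x t,\quad y + u \le 0,\quad z + x \le 1,\quad y \le \overline{\beta} z,\quad y \ge \underline{\beta} z,\quad z \ge 0,\quad x \in [0,1],\quad t \in [\underline{\gamma}, \overline{\gamma}].$$ The set $R^0 \subseteq \mathbb{R}^5$ consists of all $(x,u,y,z,t)$ satisfying $$y + u \le 0,\quad z + x \le 1,\quad y \le \overline{\beta} z,\quad y \ge \underline{\beta} z,$$ $$u - \underline{\gamma} x \ge 0,\quad \overline{\gamma} x - u \ge 0,\quad u - \underline{\gamma} x \le t - \underline{\gamma},\quad \overline{\gamma} x - u \le \overline{\gamma} - t.$$ The set $R^2$ consists of all $(x,u,y,z,t) \in R^0$ satisfying both $$(\overline{\gamma}-\underline{\gamma})y + \underline{\gamma} (\overline{\gamma} x - u) + \overline{\beta} (u - \underline{\gamma} x) \leq \overline{\beta}(t - \underline{\gamma})$$ and, in case $y > 0$ (no condition is imposed when $y \le 0$), $$(\overline{\gamma} - \underline{\gamma})y + \overline{\beta}(\overline{\gamma} x - u) + \frac{\underline{\gamma}\, y(u - \underline{\gamma} x)}{y + u - \underline{\gamma} x} \leq \overline{\beta} ( \overline{\gamma} - t ).$$ *)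

(* Defs.v *)
From mathcomp Require Import all_boot all_order all_algebra.
From mathcomp Require Import interval_inference boolp classical_sets reals convex.

Set Implicit Arguments.
Unset Strict Implicit.
Unset Printing Implicit Defensive.

Import Order.TTheory GRing.Theory Num.Theory.

Local Open Scope classical_set_scope.
Local Open Scope ring_scope.

Definition conv_hull (R : realType) (M : lmodType R) (A : set M) : set M :=
  smallest (@convex_set R M) A.

(* A point (x, u, y, z, t) of R^5 is a row vector; its column indices
   0, ..., 4 are numerals of the ring 'I_5, so there is no wrap-around.
   The bounds gl, gu, bl, bu are gamma lower/upper and beta lower/upper. *)

Definition T_set (R : realType) (gl gu bl bu : R) : set 'rV[R]_5 :=
  [set p : 'rV[R]_5 |
    let x := p 0 0 in let u := p 0 1 in let y := p 0 2 in
    let z := p 0 3 in let t := p 0 4 in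
    [/\ u = x * t, y + u <= 0 & z + x <= 1] /\
    [/\ y <= bu * z, y >= bl * z & z >= 0] /\
    0 <= x <= 1 /\ gl <= t <= gu].

Definition R0_set (R : realType) (gl gu bl bu : R) : set 'rV[R]_5 :=
  [set p : 'rV[R]_5 |
    let x := p 0 0 in let u := p 0 1 in let y := p 0 2 in
    let z := p 0 3 in let t := p 0 4 in
    [/\ y + u <= 0, z + x <= 1, y <= bu * z & y >= bl * z] /\
    [/\ u - gl * x >= 0, gu * x - u >= 0,
        u - gl * x <= t - gl & gu * x - u <= gu - t]].

Definition R2_set (R : realType) (gl gu bl bu : R) : set 'rV[R]_5 :=
  [set p : 'rV[R]_5 |
    let x := p 0 0 in let u := p 0 1 in let y := p 0 2 in
    let t := p 0 4 in
    [/\ R0_set gl gu bl bu p,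
        (gu - gl) * y + gl * (gu * x - u) + bu * (u - gl * x)
          <= bu * (t - gl) &
        (* the denominator is positive on R0_set when 0 < y *)
        0 < y ->
          (gu - gl) * y + bu * (gu * x - u)
            + (gl * y * (u - gl * x)) / (y + u - gl * x)
          <= bu * (gu - t)]].

(* Main.v *)
Require Import Defs.
From mathcomp Require Import all_boot all_order all_algebra.
From mathcomp Require Import boolp classical_sets reals.
From mathcomp Require Import interval_inference convex.
From mathcomp Require Import ring lra.

(** On [R2_set] the quantities [v = u - gl x], [w = gu x - u],
    [s = (t - gl) - v] and [r = (gu - t) - w] are nonnegative.  Divided by
    [gu - gl], they are the weights that write [(x, u, t)] as a convex
    combination of its values at the corners [(x, t) = (1, gu), (1, gl),
    (0, gu), (0, gl)], in this order.  In these normalized weights the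
    inequalities of [R2_set] that bound [y > 0] read
        [y <= - gl w - gu v],  [y <= bu (s + r)],  [y <= - gl w + bu s],
        [(y - bu r) (y + gu v) <= - gl bu v r].

    The inclusion of the hull in [R2_set] needs [R2_set] to be convex.  The
    fraction [y v / (y + v)] in its last inequality ([v] not normalized) is the
    minimum over [h] of [h^2 y + (1 - h)^2 v], and its coefficient [gl] is
    negative, so that inequality is a family of linear ones.  The members of the family whose
    coefficient of [y] is negative hold trivially when [0 < y], and the other
    ones hold trivially when [y <= 0]; keeping only the latter
    ([parallel_sum_le_halfspaces]) turns the conditional inequality into an
    intersection of half-spaces ([R2_halfspaces], [R2_convex]).

    For the reverse inclusion a point of [R2_set] is split into pieces lying in
    slices of [T_set] at constant [t].  In the slice [t], of total weight [l]
    and with total abscissa [x], [y >= 0] is allowed up to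
    [min (- t x) (bu (l - x))]; the coordinate [z] can always be shared out
    afterwards ([three_slices]).  If [y <= 0], splitting along the corners is
    enough.  If [0 < y <= - gu v + bu r], the slices [gl] (weights [w], [r]) and
    [gu] (weights [v], [s]) suffice, because
    [min (- gl w) (bu r) + min (- gu v) (bu s)] is the minimum of the four sums.
    Otherwise [v] and [r] are scarce, while [w] and [s] can be cut down to
    [w0], [s0] with [y = - gl w0 - gu v = bu (s0 + r)], and the quadratic
    inequality becomes [w0 s0 <= v r].  Moving part of [w0] and [r] to the slice
    [gl], in the proportion at which its two bounds on [y] coincide, shrinks
    the gap between [w0 s0] and [v r] until the rest satisfies [w2 s0 = v r2].
    That equality says that the four remaining weights form a single slice, at the mean of [gl] and [gu]
    with weights [w2] and [v], and both bounds on [y] are attained there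
    ([peak_weights], [mem_above_two_slices]). *)

Import Order.TTheory GRing.Theory Num.Theory.

Local Open Scope classical_set_scope.
Local Open Scope ring_scope.

(** * Points of five-space in coordinates *)

Definition vec5 {R : realType} (x u y z t : R) : 'rV[R]_5 :=
  \row_i [:: x; u; y; z; t]`_i.

Lemma vec5_coords (R : realType) (x u y z t : R) :
  ((vec5 x u y z t 0 0 = x) * (vec5 x u y z t 0 1 = u) *
   (vec5 x u y z t 0 2 = y) * (vec5 x u y z t 0 3 = z) *
   (vec5 x u y z t 0 4 = t))%type.
Proof. by do ![split]; rewrite mxE. Qed.

Lemma vec5E (R : realType) (p : 'rV[R]_5) :
  p = vec5 (p 0 0) (p 0 1) (p 0 2) (p 0 3) (p 0 4).
Proof.
apply/rowP => -[[|[|[|[|[|//]]]]] ilt]; rewrite mxE /=;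
  by congr (p _ _); apply/val_inj.
Qed.

Lemma vec5D (R : realType) (x u y z t x' u' y' z' t' : R) :
  vec5 x u y z t + vec5 x' u' y' z' t' =
  vec5 (x + x') (u + u') (y + y') (z + z') (t + t').
Proof. by apply/rowP => -[[|[|[|[|[|//]]]]] ilt]; rewrite !mxE. Qed.

Lemma vec5Z (R : realType) (l x u y z t : R) :
  l *: vec5 x u y z t = vec5 (l * x) (l * u) (l * y) (l * z) (l * t).
Proof. by apply/rowP => -[[|[|[|[|[|//]]]]] ilt]; rewrite !mxE. Qed.

(** * Conic combinations in a convex set *)

(** Scaling turns convex combinations into sums: pieces of a decomposition are
    added with their weights, and a piece of weight zero needs no separate
    treatment. *)
Definition scaled {R : realType} {M : lmodType R} (C : set M) (l : R) (p : M) :=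
  exists2 q, C q & p = l *: q.

Lemma scaledD (R : realType) (M : lmodType R) (C : set M) (l m : R) (p q : M) :
  @convex_set R M C -> 0 <= l -> 0 <= m ->
  scaled C l p -> scaled C m q -> scaled C (l + m) (p + q).
Proof.
move=> Cconv l0 m0 [p' Cp ->] [q' Cq ->].
have [lm0|lm0] := eqVneq (l + m) 0.
  have -> : l = 0 by lra.
  have -> : m = 0 by lra.
  by exists p' => //; rewrite !scale0r !addr0 scale0r.
have lm_gt0 : 0 < l + m by rewrite lt_neqAle eq_sym lm0 addr_ge0.
have k0 : 0 <= l / (l + m) by rewrite divr_ge0 // ltW.
have k1 : l / (l + m) <= 1 by rewrite ler_pdivrMr // mul1r lerDl.
have [k kE] : exists k : {i01 R}, k%:num = l / (l + m).
  by exists (Itv01 k0 k1).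
exists (conv k (p' : convex_lmodType M) q').
  by apply/set_mem/Cconv; apply/mem_set.
rewrite /conv /= scalerDr !scalerA /unstable.onem kE; congr (_ *: _ + _ *: _); by field.
Qed.

Lemma scaled1 (R : realType) (M : lmodType R) (C : set M) (p : M) :
  scaled C 1 p -> C p.
Proof. by case=> q Cq ->; rewrite scale1r. Qed.

(** * Slices of constant t *)

(** At constant [t] the equation [u = x t] is linear, so the slice of [T_set]
    is a polytope; this is the cone over it, with [l] the homogenizing
    coordinate. *)
Lemma slice_scaled (R : realType) (gl gu bl bu : R) (C : set 'rV[R]_5)
    (l t x y z : R) :
  bl < 0 -> 0 < bu -> T_set gl gu bl bu `<=` C ->
  gl <= t <= gu -> 0 <= l -> 0 <= x -> y + t * x <= 0 -> z + x <= l ->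
  y <= bu * z -> bl * z <= y ->
  scaled C l (vec5 x (t * x) y z (t * l)).
Proof.
move=> hbl hbu TC tb l0 x0 ytx zx yz zy.
have z0 : 0 <= z by nra.
have [l_eq0|l_neq0] := eqVneq l 0.
  have x_eq0 : x = 0 by lra.
  have z_eq0 : z = 0 by lra.
  have y_eq0 : y = 0 by move: yz zy; rewrite z_eq0; lra.
  exists (vec5 0 0 0 0 t); last by rewrite vec5Z l_eq0 x_eq0 z_eq0 y_eq0 !(mulr0, mul0r).
  apply: TC; rewrite /T_set /= !vec5_coords.
  by do !split; lra.
have l_gt0 : 0 < l by rewrite lt_neqAle eq_sym l_neq0.
exists (vec5 (x / l) (x / l * t) (y / l) (z / l) t); last first.
  by rewrite vec5Z; congr vec5; field.
have li : 0 < l^-1 by rewrite invr_gt0.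
have ll : l * l^-1 = 1 by rewrite mulfV.
apply: TC; rewrite /T_set /= !vec5_coords.
have {}ytx := mulr_le0_ge0 ytx (ltW li).
split; [split|split; split] => //; nra.
Qed.

(** For fixed [y >= 0] the admissible [z] form the segment from [y / bu] to
    [l - x]; its points are written with a barycentric coordinate [k] because
    both ends add up over slices, so that one [k] serves all slices at once. *)
Lemma slice_scaled_pos (R : realType) (gl gu bl bu : R) (C : set 'rV[R]_5)
    (k l t x y : R) :
  bl < 0 -> 0 < bu -> T_set gl gu bl bu `<=` C ->
  gl <= t <= gu -> 0 <= k <= 1 -> 0 <= x <= l ->
  0 <= y -> y <= - t * x -> y <= bu * (l - x) ->
  scaled C l (vec5 x (t * x) y (k * (l - x) + (1 - k) * (y / bu)) (t * l)).
Proof.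
move=> hbl hbu TC tb kb xb y0 ytx ylx.
have yE : bu * (y / bu) = y by field; lra.
have q0 : 0 <= y / bu by rewrite divr_ge0 // ltW.
have ql : y / bu <= l - x by rewrite ler_pdivrMr // mulrC.
have [z_ge z_le] : y / bu <= k * (l - x) + (1 - k) * (y / bu) /\
    k * (l - x) + (1 - k) * (y / bu) <= l - x.
  by move: (y / bu) ql => q ql; split; nra.
move: (k * _ + _) z_ge z_le => z z_ge z_le.
apply: (@slice_scaled _ gl gu bl bu) => //; try lra; first by rewrite -yE ler_pM2l.
by apply: le_trans y0; rewrite nmulr_rle0 // (le_trans q0).
Qed.

(** For [y <= 0] the coupling [y + u <= 0] is void on every slice, and only
    [(y, z)] has to be shared between the slices [gl] and [gu], in proportion to
    the room [r] and [s] that they leave to [z]. *)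
Lemma mem_nonpos (R : realType) (gl gu bl bu : R)
    (C : set 'rV[R]_5) (v w s r y z : R) :
  gl < gu -> gu < 0 -> bl < 0 -> 0 < bu ->
  @convex_set R 'rV[R]_5 C -> T_set gl gu bl bu `<=` C ->
  0 <= v -> 0 <= w -> 0 <= s -> 0 <= r -> v + w + s + r = 1 ->
  y <= 0 -> bl * z <= y -> y <= bu * z -> z <= s + r ->
  C (vec5 (v + w) (gl * w + gu * v) y z (gl * (w + r) + gu * (v + s))).
Proof.
move=> hgl hgu hbl hbu Cconv TC v0 w0 s0 r0 sum1 y0 zy yz zsr.
apply: scaled1; rewrite (_ : 1 = (w + r) + (v + s)); last by lra.
have z0 : 0 <= z by nra.
(* k is the share of (y, z) carried by the slice gl. *)
have [k /andP[k0 k1] [kr ks]] : exists2 k, 0 <= k <= 1 &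
    k * z <= r /\ (1 - k) * z <= s.
  have [sr0|sr_neq0] := eqVneq (s + r) 0.
    by exists 0; [lra|split; lra].
  have sr_gt0 : 0 < s + r by rewrite lt_neqAle eq_sym sr_neq0 addr_ge0.
  have kE : r = r / (s + r) * (s + r) by field.
  have k0 : 0 <= r / (s + r) by rewrite divr_ge0 // ltW.
  have k1 : r / (s + r) <= 1 by rewrite ler_pdivrMr // mul1r lerDr.
  exists (r / (s + r)); first by apply/andP.
  move: (r / (s + r)) kE k0 k1 => k kE k0 k1.
  have k1' : 0 <= 1 - k by lra.
  have := ler_wpM2l k0 zsr; have := ler_wpM2l k1' zsr.
  by move=> *; split; lra.
have -> : vec5 (v + w) (gl * w + gu * v) y z (gl * (w + r) + gu * (v + s)) =
    vec5 w (gl * w) (k * y) (k * z) (gl * (w + r)) +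
    vec5 v (gu * v) ((1 - k) * y) ((1 - k) * z) (gu * (v + s)).
  by rewrite vec5D; congr vec5; ring.
have kl x x' : x <= x' -> k * x <= k * x' by move=> ?; apply: ler_wpM2l.
have kr' x x' : x <= x' -> (1 - k) * x <= (1 - k) * x'.
  by move=> ?; apply: ler_wpM2l => //; lra.
have := kl _ _ zy; have := kl _ _ yz; have := kl _ _ y0.
have := kr' _ _ zy; have := kr' _ _ yz; have := kr' _ _ y0.
have w_le0 : gl * w <= 0 by rewrite nmulr_rle0 //; lra.
have v_le0 : gu * v <= 0 by rewrite nmulr_rle0.
move=> *; apply: scaledD => //; rewrite ?addr_ge0 //.
  by apply: (@slice_scaled _ gl gu bl bu) => //; lra.
by apply: (@slice_scaled _ gl gu bl bu) => //; lra.
Qed.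

(** Three slices (two outer ones and one free [t]) are enough for [y > 0];
    only [y] has to be shared out, [z] follows through the common barycentric
    coordinate [k]. *)
Lemma three_slices (R : realType) (gl gu bl bu : R)
    (C : set 'rV[R]_5) (t z xa ya la xb yb lb xc yc lc : R) :
  gl < gu -> bl < 0 -> 0 < bu ->
  @convex_set R 'rV[R]_5 C -> T_set gl gu bl bu `<=` C ->
  gl <= t <= gu -> la + lb + lc = 1 ->
  0 <= xa <= la -> 0 <= ya -> ya <= - gl * xa -> ya <= bu * (la - xa) ->
  0 <= xb <= lb -> 0 <= yb -> yb <= - gu * xb -> yb <= bu * (lb - xb) ->
  0 <= xc <= lc -> 0 <= yc -> yc <= - t * xc -> yc <= bu * (lc - xc) ->
  ya + yb + yc <= bu * z -> z <= 1 - (xa + xb + xc) ->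
  C (vec5 (xa + xb + xc) (gl * xa + gu * xb + t * xc) (ya + yb + yc) z
           (gl * la + gu * lb + t * lc)).
Proof.
move=> hgl hbl hbu Cconv TC tb sum1 xab ya0 ya1 ya2 xbb yb0 yb1 yb2
  xcb yc0 yc1 yc2 yz zx.
apply: scaled1.
pose q := (ya + yb + yc) / bu; pose h := 1 - (xa + xb + xc).
have qz : q <= z by rewrite ler_pdivrMr // mulrC.
have [k kb zE] : exists2 k, 0 <= k <= 1 & z = k * h + (1 - k) * q.
  have [hq|hq] := eqVneq h q.
    exists 0; [lra | rewrite -hq; move: qz zx; rewrite -hq /h; lra].
  have hq0 : 0 < h - q by rewrite subr_gt0 lt_neqAle eq_sym hq (le_trans qz).
  exists ((z - q) / (h - q)); last by field; lra.
  apply/andP; split; first by rewrite divr_ge0 //; lra.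
  by rewrite ler_pdivrMr // mul1r lerB.
pose zz x y l := k * (l - x) + (1 - k) * (y / bu).
have -> : z = zz xa ya la + zz xb yb lb + zz xc yc lc.
  by rewrite zE /zz /q /h -sum1; field; lra.
rewrite -!vec5D -sum1.
by do ![apply: scaledD => //; try lra];
   apply: (@slice_scaled_pos _ gl gu bl bu) => //; lra.
Qed.

(** * Points with positive y *)

(** The slices [gl] and [gu] carry at most [min (- gl w) (bu r)] and
    [min (- gu v) (bu s)]; the three bounds on [y], together with
    [y <= bu z <= bu (s + r)], say that [y] is below the sum of these. *)
Lemma mem_below_two_slices (R : realType) (gl gu bl bu : R)
    (C : set 'rV[R]_5) (v w s r y z : R) :
  gl < gu -> gu < 0 -> bl < 0 -> 0 < bu ->
  @convex_set R 'rV[R]_5 C -> T_set gl gu bl bu `<=` C ->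
  0 <= v -> 0 <= w -> 0 <= s -> 0 <= r -> v + w + s + r = 1 ->
  0 <= y -> y <= bu * z -> z <= s + r ->
  y <= - gl * w - gu * v -> y <= - gl * w + bu * s -> y <= - gu * v + bu * r ->
  C (vec5 (v + w) (gl * w + gu * v) y z (gl * (w + r) + gu * (v + s))).
Proof.
move=> hgl hgu hbl hbu Cconv TC hv hw hs hr sum1 y0 yz zsr ywv yws yvr.
have ysr : y <= bu * s + bu * r.
  by rewrite -mulrDr (le_trans yz) // ler_pM2l.
have hw' : 0 <= - gl * w by rewrite mulr_ge0 //; lra.
have hr' : 0 <= bu * r by rewrite mulr_ge0 // ltW.
have hs' : 0 <= bu * s by rewrite mulr_ge0 // ltW.
have hv' : 0 <= - gu * v by rewrite mulr_ge0 //; lra.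
have [ya [yb [[yE ya0 ya1 ya2] [yb0 yb1 yb2]]]] : exists ya yb,
    [/\ y = ya + yb, 0 <= ya, ya <= - gl * w & ya <= bu * r] /\
    [/\ 0 <= yb, yb <= - gu * v & yb <= bu * s].
  move: y0 ywv yws yvr ysr hw' hr' hs' hv' {yz}.
  move: (- gl * w) (bu * r) (bu * s) => W R' S.
  rewrite -mulNr; move: (- gu * v) => V {Cconv TC hv hw hs hr hgl hgu hbl hbu sum1 zsr}.
  move=> y0 yWV yWS yVR ySR W0 R0 S0 V0.
  have [yW|yW] := leP y W; have [yR|yR] := leP y R'.
  - by exists y, 0; do ![split]; lra.
  - by exists R', (y - R'); do ![split]; lra.
  - by exists W, (y - W); do ![split]; lra.
  have [WR|WR] := leP W R'.
    by exists W, (y - W); do ![split]; lra.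
  by exists R', (y - R'); do ![split]; lra.
have -> : vec5 (v + w) (gl * w + gu * v) y z (gl * (w + r) + gu * (v + s)) =
    vec5 (w + v + 0) (gl * w + gu * v + gl * 0) (ya + yb + 0) z
          (gl * (w + r) + gu * (v + s) + gl * 0).
  by rewrite yE; congr vec5; ring.
by apply: (@three_slices _ gl gu bl bu) => //; lra.
Qed.

(** The product equation is affine in [c], and its two sides compare as
    [w0 s0 <= v r] at [c = 0] and as [(w0 - k) s0 > 0] at [c = 1], where the
    right-hand side vanishes. *)
Lemma peak_weights (R : realFieldType) (k v w0 s0 r : R) :
  0 <= k -> k < w0 -> 0 < s0 -> 0 <= r -> w0 * s0 <= v * r ->
  exists c, [/\ 0 <= c * k <= k, 0 <= c * r <= r &
                (w0 - c * k) * s0 = v * (r - c * r)].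
Proof.
move=> k0 kw0 s0_gt0 r0 wsvr.
have ks_ws : k * s0 < w0 * s0 by rewrite ltr_pM2r.
have d_gt0 : 0 < v * r - k * s0 by rewrite subr_gt0 (lt_le_trans ks_ws).
have [c0 c1] : 0 <= (v * r - w0 * s0) / (v * r - k * s0) /\
    (v * r - w0 * s0) / (v * r - k * s0) <= 1.
  split; first by rewrite divr_ge0 //; lra.
  by rewrite ler_pdivrMr // mul1r; lra.
exists ((v * r - w0 * s0) / (v * r - k * s0)).
split; first by rewrite mulr_ge0 //= ler_piMl.
  by rewrite mulr_ge0 //= ler_piMl.
by field; rewrite lt0r_neq0.
Qed.

Lemma weighted_mean_bounds (R : realFieldType) (a b w v : R) :
  a <= b -> 0 <= w -> 0 <= v -> 0 < w + v ->
  a <= (a * w + b * v) / (w + v) <= b.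
Proof.
move=> ab w0 v0 wv0; have aw := ler_wpM2r w0 ab; have av := ler_wpM2r v0 ab.
by rewrite ler_pdivlMr // ler_pdivrMr //; lra.
Qed.

(** Here [v] and [r] limit [y]: a single slice of a well-chosen [t] makes use of
    all of [v], of what is left of [r], and of the part of [w] and [s] that it
    needs; the rest goes to the slices [gl] and [gu]. *)
Lemma mem_above_two_slices (R : realType) (gl gu bl bu : R)
    (C : set 'rV[R]_5) (v w s r y z : R) :
  gl < gu -> gu < 0 -> bl < 0 -> 0 < bu ->
  @convex_set R 'rV[R]_5 C -> T_set gl gu bl bu `<=` C ->
  0 <= v -> 0 <= w -> 0 <= s -> 0 <= r -> v + w + s + r = 1 ->
  y <= bu * z -> z <= s + r ->
  y <= - gl * w - gu * v -> - gu * v + bu * r < y ->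
  (y - bu * r) * (y + gu * v) <= - gl * bu * v * r ->
  C (vec5 (v + w) (gl * w + gu * v) y z (gl * (w + r) + gu * (v + s))).
Proof.
move=> hgl hgu hbl hbu Cconv TC hv hw hs hr sum1 yz zsr ywv yvr ycond.
have ysr : y <= bu * s + bu * r.
  by rewrite -mulrDr (le_trans yz) // ler_pM2l.
have hr' : 0 <= bu * r by rewrite mulr_ge0 // ltW.
have hv' : 0 <= - gu * v by rewrite mulr_ge0 //; lra.
have A0 : 0 < - gl by lra.
have A_neq0 : - gl != 0 by rewrite lt0r_neq0.
(* w0 and s0 are the amounts of w and s for which
   y = - gl * w0 - gu * v = bu * (s0 + r). *)
have [w0 w0E] : exists w0, - gl * w0 = y + gu * v.
  by exists ((y + gu * v) / - gl); rewrite mulrCA divff // mulr1.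
have [s0 s0E] : exists s0, bu * s0 = y - bu * r.
  by exists ((y - bu * r) / bu); rewrite mulrCA divff ?mulr1 // lt0r_neq0.
(* k is the weight w with which r is balanced on the slice gl: both bounds on y
   coincide there for the weights k and r, hence for any multiple of them. *)
have [k kE] : exists k, - gl * k = bu * r.
  by exists ((bu * r) / - gl); rewrite mulrCA divff // mulr1.
have w0w : w0 <= w by rewrite -(ler_pM2l A0); lra.
have s0s : s0 <= s by rewrite -(ler_pM2l hbu); lra.
have s0_gt0 : 0 < s0 by rewrite -(ltr_pM2l hbu) mulr0; lra.
have k0 : 0 <= k by rewrite -(ler_pM2l A0) mulr0 kE.
have kw0 : k < w0 by rewrite -(ltr_pM2l A0); lra.
have ws_vr : w0 * s0 <= v * r.
  have P : 0 < - gl * bu by rewrite mulr_gt0.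
  by rewrite -(ler_pM2l P) mulrACA w0E s0E mulrC mulrA.
have [c [/andP[ck0 ckk] /andP[cr0 crr] cE]] :=
  @peak_weights _ _ v _ _ _ k0 kw0 s0_gt0 hr ws_vr.
have ckE : - gl * (c * k) = bu * (c * r) by rewrite mulrCA kE mulrCA.
move: (c * k) (c * r) ck0 ckk cr0 crr cE ckE => w1 r1 w1_ge0 w1k r1_ge0 r1r cE w1E.
pose w2 := w0 - w1; pose r2 := r - r1.
have xc_gt0 : 0 < w2 + v by rewrite /w2; lra.
(* The mean of gl and gu for the weights w2, v is also the one for r2, s0,
   by cE: so the weights v, w2, s0, r2 lie in one slice. *)
pose t := (gl * w2 + gu * v) / (w2 + v).
have tx : t * (w2 + v) = gl * w2 + gu * v by rewrite /t mulfVK // lt0r_neq0.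
have tl : t * (s0 + r2) = gl * r2 + gu * s0.
  apply: (mulIf (lt0r_neq0 xc_gt0)); rewrite mulrAC tx.
  have : w2 * s0 = v * r2 by [].
  by move: w2 r2 {xc_gt0 t tx} => w2 r2 E; ring: E.
have tb : gl <= t <= gu.
  by apply: weighted_mean_bounds => //; [exact: ltW | rewrite /w2; lra].
have -> : vec5 (v + w) (gl * w + gu * v) y z (gl * (w + r) + gu * (v + s)) =
    vec5 ((w - w2) + 0 + (w2 + v))
      (gl * (w - w2) + gu * 0 + t * (w2 + v))
      (- gl * w1 + 0 + (- gl * w2 - gu * v)) z
      (gl * (w - w2 + (r - r2)) + gu * (s - s0) + t * ((w2 + v) + (s0 + r2))).
  by rewrite [t * (_ + (s0 + _))]mulrDr tx tl; congr vec5; rewrite /w2; lra.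
have tx' : - t * (w2 + v) = - gl * w2 - gu * v by rewrite mulNr tx; ring.
have w2A : 0 <= - gl * w2 by rewrite mulr_ge0 //; [exact: ltW | rewrite /w2; lra].
have w1A : 0 <= - gl * w1 by rewrite mulr_ge0 // ltW.
move: w2A; rewrite /w2 => w2A.
by apply: (@three_slices _ gl gu bl bu) => //; rewrite ?mulr0 ?tx' /r2 /w2; lra.
Qed.

(** * Convexity of the outer description *)

(** The fraction is the minimum over [h] of [h^2 y + (1 - h)^2 v], attained at
    [h = v / (y + v)].  The restriction [0 <= D + a h^2] makes the inequality
    for [h] true when [y <= 0], and loses nothing when [0 < y] since without it
    the left-hand side is nonpositive. *)
Lemma parallel_sum_le_halfspaces (R : realFieldType) (D a y v rho : R) :
  a < 0 -> 0 <= v -> 0 <= rho ->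
  (0 < y -> D * y + a * y * v / (y + v) <= rho) <->
  (forall h, 0 <= D + a * h ^+ 2 ->
     D * y + a * (h ^+ 2 * y + (1 - h) ^+ 2 * v) <= rho).
Proof.
move=> a0 v0 rho0; split=> [H h Dh | H y0].
  have hv : a * ((1 - h) ^+ 2 * v) <= 0.
    by rewrite nmulr_rle0 // mulr_ge0 // sqr_ge0.
  have [y0|y0] := leP y 0.
    have := mulr_ge0_le0 Dh y0; lra.
  have yv0 : 0 < y + v by lra.
  apply: le_trans (H y0); rewrite lerD2l -[a * y * v]mulrA -mulrA ler_nM2l //.
  (* After clearing y + v the two sides differ by this square. *)
  by rewrite ler_pdivrMr //; have := sqr_ge0 (h * y - (1 - h) * v); lra.
have yv0 : 0 < y + v by lra.
pose h := v / (y + v).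
have hE : a * y * v / (y + v) = a * (h ^+ 2 * y + (1 - h) ^+ 2 * v).
  by rewrite /h; field; lra.
rewrite hE; have [Dh|Dh] := leP 0 (D + a * h ^+ 2); first exact: H.
have hv : a * ((1 - h) ^+ 2 * v) <= 0.
  by rewrite nmulr_rle0 // mulr_ge0 // sqr_ge0.
have := mulr_le0_ge0 (ltW Dh) (ltW y0); lra.
Qed.

Lemma R2_halfspaces (R : realType) (gl gu bl bu : R) (p : 'rV[R]_5) :
  gl < 0 -> 0 < bu ->
  let x := p 0 0 in let u := p 0 1 in let y := p 0 2 in let t := p 0 4 in
  R2_set gl gu bl bu p <->
  [/\ R0_set gl gu bl bu p,
      (gu - gl) * y + gl * (gu * x - u) + bu * (u - gl * x)
        <= bu * (t - gl) &
      forall h, 0 <= gu - gl + gl * h ^+ 2 ->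
        (gu - gl) * y + gl * (h ^+ 2 * y + (1 - h) ^+ 2 * (u - gl * x))
          <= bu * (gu - t) - bu * (gu * x - u)].
Proof.
move=> hgl hbu x u y t; rewrite /R2_set /= -/x -/u -/y -/t.
have E : R0_set gl gu bl bu p ->
    (0 < y -> (gu - gl) * y + bu * (gu * x - u) +
       gl * y * (u - gl * x) / (y + u - gl * x) <= bu * (gu - t)) <->
    (forall h, 0 <= gu - gl + gl * h ^+ 2 ->
       (gu - gl) * y + gl * (h ^+ 2 * y + (1 - h) ^+ 2 * (u - gl * x))
         <= bu * (gu - t) - bu * (gu * x - u)).
  case=> _ [v0 _ _ r0].
  have rho0 : 0 <= bu * (gu - t) - bu * (gu * x - u).
    by rewrite subr_ge0; apply: ler_wpM2l r0; exact: ltW.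
  apply: iff_trans (@parallel_sum_le_halfspaces _ _ _ _ _ _ hgl v0 rho0).
  by rewrite -(addrA y); split=> H y0; move: (H y0); move: (_ / _) => P; lra.
by split=> -[H0 H1 /(E H0) H2].
Qed.

Lemma R2_convex (R : realType) (gl gu bl bu : R) :
  gl < 0 -> 0 < bu -> @convex_set R 'rV[R]_5 (R2_set gl gu bl bu).
Proof.
move=> hgl hbu p q l /set_mem/(R2_halfspaces _ _ _ _ _ _ hgl hbu) [].
case=> -[p1 p2 p3 p4] [p5 p6 p7 p8] p9 pH.
move=> /set_mem/(R2_halfspaces _ _ _ _ _ _ hgl hbu) [].
case=> -[q1 q2 q3 q4] [q5 q6 q7 q8] q9 qH.
apply/mem_set/(R2_halfspaces _ _ _ _ _ _ hgl hbu).
have l0 : 0 <= l%:num by [].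
have l1 : 0 <= 1 - l%:num by rewrite subr_ge0.
have E i : conv l p q 0 i = l%:num * p 0 i + (1 - l%:num) * q 0 i.
  by rewrite !mxE.
rewrite /R0_set /= !E.
move: (l%:num) l0 l1 {E} => k k0 k1.
have comb a b c d : a <= b -> c <= d -> k * a + (1 - k) * c <= k * b + (1 - k) * d.
  by move=> ab cd; apply: lerD; apply: ler_wpM2l.
split; last 1 first.
- by move=> h Dh; have := comb _ _ _ _ (pH h Dh) (qH h Dh); lra.
- split; split.
  + by have := comb _ _ _ _ p1 q1; lra.
  + by have := comb _ _ _ _ p2 q2; lra.
  + by have := comb _ _ _ _ p3 q3; lra.
  + by have := comb _ _ _ _ p4 q4; lra.
  + by have := comb _ _ _ _ p5 q5; lra.
  + by have := comb _ _ _ _ p6 q6; lra.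
  + by have := comb _ _ _ _ p7 q7; lra.
  + by have := comb _ _ _ _ p8 q8; lra.
- by have := comb _ _ _ _ p9 q9; lra.
Qed.

(** * Equality of the hull and its description *)

(** On [T_set], split [(gu - gl) y] into [(gu - t) y + (t - gl) y].  In the
    linear inequality the first part is bounded by means of [y <= - x t] and the
    second one by means of [y <= bu (1 - x)]; in the fractional inequality the
    roles are exchanged. *)
Lemma T_sub_R2 (R : realType) (gl gu bl bu : R) :
  gl < 0 -> gu < 0 -> 0 < bu -> T_set gl gu bl bu `<=` R2_set gl gu bl bu.
Proof.
move=> hgl hgu hbu p; rewrite /T_set /R2_set /R0_set /=.
move: (p 0 0) (p 0 1) (p 0 2) (p 0 3) (p 0 4) => x u y z t.
case=> -[-> yu zx] [[yz zy z0] [/andP[x0 x1] /andP[t0 t1]]].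
have x1' : 0 <= 1 - x by lra.
have t0' : 0 <= t - gl by lra.
have t1' : 0 <= gu - t by lra.
have yx : y <= bu * (1 - x) by rewrite (le_trans yz) // ler_pM2l //; lra.
have xt0 := mulr_ge0 x0 t0'; have xt1 := mulr_ge0 x0 t1'.
have xt2 := mulr_ge0 x1' t0'; have xt3 := mulr_ge0 x1' t1'.
have yt0 := ler_wpM2l t0' yx; have yt1 := ler_wpM2l t1' yx.
split; first by do !split; lra.
  have := mulr_ge0_le0 t1' yu; have := mulr_ge0 xt1 t0'; lra.
move=> y0.
have -> : y + x * t - gl * x = y + x * (t - gl) by ring.
have -> : x * t - gl * x = x * (t - gl) by ring.
have d0 : 0 < y + x * (t - gl) by lra.
have key : gl * y * (x * (t - gl)) / (y + x * (t - gl)) <= - (t - gl) * y.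
  rewrite ler_pdivrMr //.
  have := mulr_ge0_le0 (mulr_ge0 t0' (ltW y0)) yu; lra.
by move: key; move: (_ / _) => P key; lra.
Qed.

Theorem theorem4p2 (R : realType) (gl gu bl bu : R)
    (hgl : gl < gu) (hgu : gu < 0) (hbl : bl < 0) (hbu : 0 < bu) :
  conv_hull (T_set gl gu bl bu) = R2_set gl gu bl bu.
Proof.
have hgl0 : gl < 0 by apply: lt_trans hgu.
apply/seteqP; split.
  by apply: smallest_sub; [exact: R2_convex | exact: T_sub_R2].
move=> p [[[yu zx yz zy] [v0 w0 s0 r0]] cond1 cond2] C [Cconv TC].
rewrite (vec5E _ p).
move: (p 0 0) (p 0 1) (p 0 2) (p 0 3) (p 0 4) yu zx yz zy v0 w0 s0 r0 cond1 cond2.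
move=> x u y z t {p} yu zx yz zy v0 w0 s0 r0 cond1 cond2.
pose D := gu - gl; have D0 : 0 < D by rewrite subr_gt0.
(* The normalized corner weights of (x, u, t). *)
have [v vE] : exists v, D * v = u - gl * x.
  by exists ((u - gl * x) / D); rewrite mulrCA divff ?mulr1 // lt0r_neq0.
have [w wE] : exists w, D * w = gu * x - u.
  by exists ((gu * x - u) / D); rewrite mulrCA divff ?mulr1 // lt0r_neq0.
have [s sE] : exists s, D * s = t - gl - (u - gl * x).
  by exists ((t - gl - (u - gl * x)) / D); rewrite mulrCA divff ?mulr1 // lt0r_neq0.
have [r rE] : exists r, D * r = gu - t - (gu * x - u).
  by exists ((gu - t - (gu * x - u)) / D); rewrite mulrCA divff ?mulr1 // lt0r_neq0.
have DI := mulfI (lt0r_neq0 D0).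
have xE : x = v + w by apply: DI; rewrite mulrDr vE wE /D; ring.
have sum1 : v + w + s + r = 1.
  by apply: DI; rewrite !mulrDr vE wE sE rE /D; ring.
have uE : u = gl * w + gu * v.
  by apply: DI; rewrite mulrDr ![D * (_ * _)]mulrCA vE wE /D; ring.
have tE : t = gl * (w + r) + gu * (v + s).
  by apply: DI; rewrite mulrDr ![D * (_ * _)]mulrCA !mulrDr vE wE sE rE /D; ring.
have hv : 0 <= v by rewrite -(ler_pM2l D0) mulr0 vE.
have hw : 0 <= w by rewrite -(ler_pM2l D0) mulr0 wE.
have hs : 0 <= s by rewrite -(ler_pM2l D0) mulr0 sE subr_ge0.
have hr : 0 <= r by rewrite -(ler_pM2l D0) mulr0 rE subr_ge0.
have zsr : z <= s + r by lra.
have yws : y <= - gl * w + bu * s.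
  rewrite -(ler_pM2l D0) mulrDr ![D * (_ * _)]mulrCA wE sE /D; lra.
rewrite xE uE tE.
have [y0|y0] := leP y 0; first exact: (@mem_nonpos _ gl gu bl bu).
have ywv : y <= - gl * w - gu * v by lra.
have [yvr|yvr] := leP y (- gu * v + bu * r).
  by apply: (@mem_below_two_slices _ gl gu bl bu) => //; exact: ltW.
apply: (@mem_above_two_slices _ gl gu bl bu) => //.
have d0 : 0 < y + D * v by rewrite ltr_wpDr // mulr_ge0 // ltW.
(* Clearing the denominator y + D * v gives the quadratic bound times D. *)
have := cond2 y0; rewrite -(addrA y) -vE -wE -/D.
have := divfK (lt0r_neq0 d0) (gl * y * (D * v)).
move: (_ / _) => P PE.
have rE' : bu * (gu - t) = bu * (D * r) + bu * (D * w) by rewrite rE wE; ring.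
rewrite rE' addrAC lerD2r -(ler_pM2r d0) mulrDl PE => cond.
rewrite -(ler_pM2l D0); move: cond; rewrite /D; lra.
Qed.
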